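(* Let $n\ge 3$ be an odd integer and let $F_n = P_{n-1}+v_0$ be the fan on $n$ vertices. Then the detour monophonic vertex cover pebbling number of $F_n$ is $$\mu_{vc}(F_n) = \sum_{j=0}^{\lfloor n/2\rfloor-1} 2^{2j} + 2.$$
   Context: The fan $F_n=P_{n-1}+v_0$ of order $n$ is the graph with vertices $v_0,v_1,\dots,v_{n-1}$ in which $v_1,\dots,v_{n-1}$ form a path (in this order) and the hub $v_0$ is adjacent to every $v_i$, $1\le i\le n-1$. All graphs are finite, simple and connected. A pebbling move removes two pebbles from a vertex and places one pebble on an adjacent vertex (the other pebble is lost). A vertex cover of a graph $G$ is a set $D_{vc}\subseteq V(G)$ such that every edge of $G$ has at least one endpoint in $D_{vc}$. A detour monophonic path between two vertices $x,y$ is a longest chordless (i.e. induced) path between $x$ and $y$. The detour monophonic distance $D_m(x,y)$ is its length (number of edges), so $D_m(x,x)=0$ and $D_m(x,y)=1$ if $x,y$ are adjacent. Pebbles are transported from the source vertex only along detour monophonic paths, so bringing one pebble from a vertex $\dot s$ to a vertex $u$ uses $2^{D_m(\dot s,u)}$ pebbles of $\dot s$ (and a pebble kept on $\dot s$ itself uses one). The detour monophonic vertex cover pebbling number $\mu_{vc}(G)$ is the minimum number $m$ such that, for every choice of source vertex $\dot s\in V(G)$, if $m$ pebbles are placed on $\dot s$, then one can place at least one pebble on every vertex of some minimum-cardinality vertex cover of $G$ by transporting pebbles along detour monophonic paths. Equivalently, $$\mu_{vc}(G)=\max_{\dot s\in V(G)}\ \min_{D}\ \sum_{u\in D}2^{D_m(\dot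 s,u)},$$ where $D$ ranges over the vertex covers of $G$ of minimum cardinality. *)

(* Defs.v *)
From mathcomp Require Import all_boot.

Set Implicit Arguments.
Unset Strict Implicit.
Unset Printing Implicit Defensive.

(* A simple graph is given by its adjacency relation, a symmetric and
   irreflexive e : rel T on a finType T. *)

Section Graph.

Variables (T : finType) (e : rel T).

Definition vertex_cover (D : {set T}) : Prop :=
  forall x y, e x y -> (x \in D) || (y \in D).

Definition minimum_vertex_cover (D : {set T}) : Prop :=
  vertex_cover D /\ forall D', vertex_cover D' -> #|D| <= #|D'|.

(* As in path.v, the path x :: p goes from x to last x p and has length
   (number of edges) size p. *)
Definition chordless_path (x : T) (p : seq T) : Prop :=
  [/\ path e x p, uniq (x :: p)
    & forall i j, i.+1 < j -> j <= size p ->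
        ~~ e (nth x (x :: p) i) (nth x (x :: p) j)].

Definition detour_monophonic_path (x : T) (p : seq T) : Prop :=
  chordless_path x p /\
  forall q, chordless_path x q -> last x q = last x p -> size q <= size p.

Definition config := {ffun T -> nat}.

Definition place (s : T) (m : nat) : config :=
  [ffun z => if z == s then m else 0].

(* The truncated subtraction is exact whenever the move is legal, see play. *)
Definition pebbling_move (c : config) (x y : T) : config :=
  [ffun z => c z - 2 * (z == x) + (z == y)].

Fixpoint play (c : config) (ms : seq (T * T)) (c' : config) : Prop :=
  if ms is (x, y) :: ms' then [/\ e x y, 2 <= c x & play (pebbling_move c x y) ms' c']
  else c' = c.

(* The pebbling moves that bring one pebble from x to last x p along x :: p:
   2 ^ (size p).-1 moves over the first edge, half as many over the next one,
   and so on. They consume 2 ^ size p pebbles of x; there are none if p is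
   empty, as a pebble is then just kept on x. *)
Fixpoint transport (x : T) (p : seq T) : seq (T * T) :=
  if p is y :: p' then nseq (2 ^ size p') (x, y) ++ transport y p' else [::].

(* Each element of ps is the route of one pebble out of the source s. *)
Definition can_pebble (s : T) (m : nat) (D : {set T}) : Prop :=
  exists (ps : seq (seq T)) (c : config),
    [/\ forall p, p \in ps -> detour_monophonic_path s p,
        play (place s m) (flatten [seq transport s p | p <- ps]) c
      & forall u, u \in D -> 1 <= c u].

Definition enough_pebbles (m : nat) : Prop :=
  forall s, exists2 D, minimum_vertex_cover D & can_pebble s m D.

(* m is the detour monophonic vertex cover pebbling number of the graph. *)
Definition is_mu_vc (m : nat) : Prop :=
  enough_pebbles m /\ forall m', enough_pebbles m' -> m <= m'.

End Graph.

(* Vertex v_i is the ordinal i : 'I_n; the hub is v_0. *)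
Definition fan (n : nat) : rel 'I_n := fun i j =>
  (i != j) &&
  [|| val i == 0, val j == 0, (val i).+1 == val j | (val j).+1 == val i].

Lemma fan_sym n : symmetric (@fan n).
Proof.
by move=> i j; rewrite /fan eq_sym orbCA [(_.+1 == _) || _]orbC.
Qed.

Lemma fan_irr n : irreflexive (@fan n).
Proof. by move=> i; rewrite /fan eqxx. Qed.

(* Main.v *)
Require Import Defs.
From mathcomp Require Import all_boot.
From mathcomp Require Import zify.

(** A route of length d out of the source uses up exactly 2 ^ d of its pebbles
and delivers one pebble at its end, whatever else is done before or after:
along a sequence of routes the number of pebbles on every vertex is thus known
in closed form ([play_routes_balance]), and a cover D can be pebbled from s
with m pebbles exactly when the sum of 2 ^ D_m(s, u) over D is at most m
([can_pebbleP]). The problem becomes one about distances.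

In the fan, a chordless path through the hub has at most two edges, and one
that avoids the hub runs monotonically along v_1, ..., v_(n-1). Hence D_m is 1
between the hub and any other vertex, and |i - j| between v_i and v_j
([fan_detour_dist]).

Write n = 2k + 1 and group v_1, ..., v_(2k) into the k edges
v_(2j+1) v_(2j+2). A vertex cover meets each of them, and if it misses the hub
it contains both ends of each, so that the surplus in the first edge makes up
for the hub. For any weight w growing along each of these edges, with w_0 <= w_2,
this gives the lower bound w_0 + sum_j w_(2j+1) of [fan_cover_sum_ge]. With w = 1 it says that
a cover has at least k + 1 vertices; with w = 2 ^ D_m(v_1, _) it says that the
source v_1 needs 2 + sum_j 4 ^ j pebbles.

Conversely, for a source v_s with s > 0 take in each edge the end nearer to
v_s, together with the hub. This is a minimum cover ([fan_cover_minimum]), and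
its cost is at most the one for s = 1. If S(l) denotes the sum of 4 ^ j over
j < l and s cuts the k edges into a edges on its left and b on its right, the cost apart
from the hub is S(a) + 2 S(b) or 2 S(a) + S(b) according to the parity of s,
and S(a + b) = S(a) + 4 ^ a S(b) dominates it ([path_cost_le]).
For the hub as source all distances are at most 1, and k + 1 vertices are cheap
to reach ([hub_cost_le]). *)

Set Implicit Arguments.
Unset Strict Implicit.
Unset Printing Implicit Defensive.

(** * Balance of pebbles along routes *)

Section Cost.

Variables (T : finType) (e : rel T).
Implicit Types (c : config T) (x s u : T) (p : seq T) (ps : seq (seq T)).

Lemma play_cat c ms1 ms2 c' :
  play e c (ms1 ++ ms2) c' <->
  exists2 c1, play e c ms1 c1 & play e c1 ms2 c'.
Proof.
elim: ms1 c => [|[x y] ms IH] c /=.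
  by split=> [h|[_ -> //]]; exists c.
split=> [[exy c2 /IH[c1 h1 h2]]|[c1 [exy c2 h1] h2]]; first by exists c1.
by split=> //; apply/IH; exists c1.
Qed.

Lemma play_nseq_balance k c x y c' z :
  play e c (nseq k (x, y)) c' ->
  c' z + 2 * k * (z == x) = c z + k * (z == y).
Proof.
elim: k c => [|k IH] c /=; first by move=> ->; lia.
case=> _ c2 /IH; rewrite ffunE.
by have [-> | _] := eqVneq z x; lia.
Qed.

(** The intermediate vertices of a route are emptied as much as they are
filled. The equation has additions only, so it also covers the empty route,
where the two extra terms are equal even if x carries no pebble. *)
Lemma play_transport_balance c x p c' z :
  play e c (transport x p) c' ->
  c' z + 2 ^ size p * (z == x) = c z + (z == last x p).
Proof.
elim: p x c => [|y p IH] x c /=; first by move=> ->; lia.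
case/play_cat => c1 /(play_nseq_balance z) h1 /IH h2.
by move: h1 h2; rewrite expnS; lia.
Qed.

Lemma play_routes_balance s c ps c' z :
  play e c (flatten [seq transport s p | p <- ps]) c' ->
  c' z + (\sum_(p <- ps) 2 ^ size p) * (z == s)
  = c z + \sum_(p <- ps) (z == last s p).
Proof.
elim: ps c => [|p ps IH] c /=; first by move=> ->; rewrite !big_nil.
case/play_cat => c1 /(play_transport_balance z) h1 /IH h2.
by move: h1 h2; rewrite !big_cons; lia.
Qed.

Lemma play_nseq_exists k c x y :
  e x y -> 2 * k <= c x -> exists c', play e c (nseq k (x, y)) c'.
Proof.
move=> exy; elim: k c => [|k IH] c hk /=; first by exists c.
have [|c' h] := IH (pebbling_move c x y); first by rewrite ffunE eqxx; lia.
by exists c'; split=> //; lia.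
Qed.

Lemma play_transport_exists c x p :
  path e x p -> 2 ^ size p <= c x -> exists c', play e c (transport x p) c'.
Proof.
elim: p x c => [|y p IH] x c /=; first by exists c.
case/andP => exy hp; rewrite expnS => hc.
have [c1 h1] := play_nseq_exists exy hc.
have [|c' h2] := IH y c1 hp.
  have := play_nseq_balance y h1; rewrite eqxx muln1.
  by case: eqP => [->|_]; rewrite ?muln1 ?muln0; [lia | rewrite addn0 => ->; rewrite leq_addl].
by exists c'; apply/play_cat; exists c1.
Qed.

Lemma play_routes_exists s c ps :
  (forall p, p \in ps -> path e s p) -> \sum_(p <- ps) 2 ^ size p <= c s ->
  exists c', play e c (flatten [seq transport s p | p <- ps]) c'.
Proof.
elim: ps c => [|p ps IH] c hps /=; first by exists c.
rewrite big_cons => hc.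
have [||c1 h1] := @play_transport_exists c s p; first by apply: hps; rewrite mem_head.
  by lia.
have [||c' h2] := IH c1.
- by move=> q qps; apply: hps; rewrite inE qps orbT.
- move: hc (play_transport_balance s h1); rewrite eqxx muln1.
  by case: (s == _); rewrite ?addn1 ?addn0; lia.
by exists c'; apply/play_cat; exists c1.
Qed.

(** The distance D_m as a relation, as the lengths of the chordless paths are
compared here without enumerating these paths. *)
Definition detour_dist s u d :=
  exists p, [/\ detour_monophonic_path e s p, last s p = u & size p = d].

Lemma detour_dist_le s p d :
  detour_monophonic_path e s p -> detour_dist s (last s p) d -> d <= size p.
Proof. by case=> _ hmax [q [[hq _] lq <-]]; apply: hmax. Qed.

Lemma detour_dist_refl s d : detour_dist s s d -> d = 0.
Proof.
case=> -[|x p] [] //= [[_ /= /andP[+ _] _] _] ls _.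
by rewrite -{1}ls mem_last.
Qed.

(** Sufficiency sends one pebble to each vertex of D. For necessity, weigh a
pebble on u by 2 ^ d u: a route of length l takes weight 2 ^ l from the source,
which has weight 1, and restores 2 ^ d u <= 2 ^ l at its end u, so the total
weight, initially m, never grows. *)
Lemma can_pebbleP s (d : T -> nat) m (D : {set T}) :
  (forall u, detour_dist s u (d u)) ->
  can_pebble e s m D <-> \sum_(u in D) 2 ^ d u <= m.
Proof.
move=> hd; split.
  case=> ps [c [hps hplay hD]].
  have bal z := play_routes_balance z hplay.
  have ds : d s = 0 by apply/detour_dist_refl/hd.
  have leD : \sum_(u in D) 2 ^ d u <= \sum_u c u * 2 ^ d u.
    rewrite big_mkcond; apply: leq_sum => u _; case: ifP => // uD.
    by rewrite leq_pmull // hD.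
  apply: (leq_trans leD).
  have pick1 (x : T) (F : T -> nat) : \sum_u (u == x) * F u = F x.
    by rewrite (bigD1 x) //= eqxx mul1n big1 ?addn0 // => u /negbTE ->.
  (* The balance equations of all vertices, weighted by 2 ^ d u and added. *)
  have tot : \sum_u c u * 2 ^ d u + \sum_(p <- ps) 2 ^ size p
             = m + \sum_(p <- ps) 2 ^ d (last s p).
    have -> : \sum_(p <- ps) 2 ^ size p
            = \sum_u (u == s) * ((\sum_(p <- ps) 2 ^ size p) * 2 ^ d u).
      by rewrite pick1 ds muln1.
    have -> : m = \sum_u (u == s) * (m * 2 ^ d u) by rewrite pick1 ds muln1.
    have -> : \sum_(p <- ps) 2 ^ d (last s p)
            = \sum_u (\sum_(p <- ps) (u == last s p)) * 2 ^ d u.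
      under [RHS]eq_bigr do rewrite big_distrl /=.
      rewrite exchange_big /=; apply: eq_bigr => p _.
      by rewrite pick1.
    rewrite -!big_split /=; apply: eq_bigr => u _.
    move: (bal u); rewrite ffunE => h.
    rewrite mulnA -mulnDl [_ * \sum_(_ <- _) _]mulnC h.
    by case: (u == s); rewrite ?mulnDl; lia.
  suff : \sum_(p <- ps) 2 ^ d (last s p) <= \sum_(p <- ps) 2 ^ size p by lia.
  rewrite big_seq [leqRHS]big_seq; apply: leq_sum => p /hps hp.
  by rewrite leq_exp2l //; apply: detour_dist_le hp (hd _).
move=> hm.
have /fin_all_exists[f hf] := hd.
pose ps := [seq f u | u <- enum D].
have sumps : \sum_(p <- ps) 2 ^ size p = \sum_(u in D) 2 ^ d u.
  by rewrite big_map big_enum /=; apply: eq_bigr => u _; case: (hf u) => _ _ ->.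
have [||c hc] := @play_routes_exists s (place s m) ps.
- by move=> p /mapP[u _ ->]; case: (hf u) => -[[]].
- by rewrite ffunE eqxx sumps.
exists ps, c; split=> // [p /mapP[u _ ->]|u uD]; first by case: (hf u).
have := play_routes_balance u hc; rewrite sumps ffunE.
have : 0 < \sum_(p <- ps) (u == last s p).
  rewrite big_map big_enum /= (bigD1 u) //=.
  by case: (hf u) => _ -> _; rewrite eqxx.
by case: (u == s); lia.
Qed.

Lemma detour_dist_self s : detour_dist s s 0.
Proof.
exists [::]; split=> //; split.
  by split=> // i j ij /=; rewrite leqn0 => /eqP j0; rewrite j0 in ij.
move=> [|y q] // [_ /= /andP[+ _] _] /= ls.
by rewrite -{1}ls mem_last.
Qed.

(** An edge between the ends is a chord of every longer path. *)
Lemma detour_dist_adj s u : s != u -> e s u -> detour_dist s u 1.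
Proof.
move=> su esu; exists [:: u]; split=> //; split.
  by split=> [||i j] /=; rewrite ?esu ?inE ?su //; lia.
move=> q [_ _ hq] /= lq; rewrite leqNgt; apply/negP => q2.
have := hq 0 (size q) q2 (leqnn _).
by rewrite /= -last_nth lq esu.
Qed.

(** Presents a chordless path by a numbering f of its vertices, so that
adjacency reduces to arithmetic on the indices. *)
Lemma chordless_mkseq k (f : nat -> T) :
  {in [pred i | i <= k] &, injective f} ->
  (forall i, i < k -> e (f i) (f i.+1)) ->
  (forall i j, i.+1 < j -> j <= k -> ~~ e (f i) (f j)) ->
  chordless_path e (f 0) (mkseq (f \o succn) k).
Proof.
move=> finj fe fne.
have E : f 0 :: mkseq (f \o succn) k = mkseq f k.+1.
  by rewrite /mkseq /= (iotaDl 1 0 k) -map_comp; congr cons; apply: eq_map.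
split.
- apply/(pathP (f 0)) => i; rewrite size_mkseq => ik.
  by rewrite E !nth_mkseq ?fe // ltnW.
- rewrite E; apply/mkseq_uniqP => i j; rewrite !inE !ltnS; exact: finj.
- move=> i j ij; rewrite size_mkseq => jk.
  by rewrite E !nth_mkseq ?fne //; lia.
Qed.

End Cost.

(** * Detour distances in the fan *)

Lemma last_mkseq_succ (T : Type) (f : nat -> T) k :
  last (f 0) (mkseq (f \o succn) k) = f k.
Proof. by case: k => // k; rewrite /mkseq -addn1 iotaD map_cat last_cat /= addn1. Qed.

Definition consecutive : rel nat := fun a b => (a.+1 == b) || (b.+1 == a).

(** A path in the integers without repetition cannot turn back, so its first
step fixes its direction. *)
Lemma consecutive_up x p :
  path consecutive x.+1 p -> uniq [:: x, x.+1 & p] ->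
  last x.+1 p = x.+1 + size p.
Proof.
elim: p x => [|y p IH] x /=; first by rewrite addn0.
case/andP => /orP[/eqP <- | /eqP[->]] hp.
  by case/andP=> _ h; rewrite IH // addSnnS.
by rewrite !inE eqxx !orbT.
Qed.

Lemma consecutive_down x p :
  path consecutive x p -> uniq [:: x.+1, x & p] -> last x p + size p = x.
Proof.
elim: p x => [|y p IH] x /=; first by rewrite addn0.
case/andP => /orP[/eqP <- | /eqP <-] hp.
  by rewrite !inE eqxx !orbT.
by case/andP=> _ h; rewrite addnS IH.
Qed.

Lemma consecutive_size x p :
  path consecutive x p -> uniq (x :: p) ->
  size p = (last x p - x) + (x - last x p).
Proof.
case: p => [|y p]; first by rewrite /= subnn.
rewrite [path _ _ _]/=; case/andP => /orP[/eqP <- | /eqP <-] hp hu.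
  by rewrite /= (consecutive_up hp hu); lia.
by have /= := consecutive_down hp hu; lia.
Qed.

Definition fan_dist (s u : nat) : nat :=
  if s == u then 0 else if (s == 0) || (u == 0) then 1 else (u - s) + (s - u).

Lemma fan_dist_path s u : 0 < s -> 0 < u -> fan_dist s u = (u - s) + (s - u).
Proof.
rewrite /fan_dist; case: eqP => [->|_]; first by rewrite subnn.
by case: s; case: u.
Qed.

Section Fan.

Variable k : nat.
Local Notation n := (k.*2.+1).
Implicit Types s u : 'I_n.

Lemma fan_straight s u : 0 < s -> 0 < u ->
  exists p, [/\ chordless_path (@fan n) s p, last s p = u & size p = (u - s) + (s - u)].
Proof.
move=> s0 u0; have [sn un] := (ltn_ord s, ltn_ord u).
pose f i : 'I_n := inord (if s <= u then s + i else s - i).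
set l := (u - s) + (s - u).
have fE i : i <= l -> f i = (if s <= u then s + i else s - i) :> nat.
  by rewrite /l /f => il; rewrite inordK //; case: (leqP s u); lia.
have f0 : f 0 = s by apply: val_inj; rewrite /= fE //; case: (leqP s u); lia.
have fl : f l = u by apply: val_inj; rewrite /= fE // /l; case: (leqP s u); lia.
exists (mkseq (f \o succn) l); split; last by rewrite size_mkseq.
  rewrite -f0; apply: chordless_mkseq.
  - move=> i j; rewrite !inE => il jl /(congr1 val) /=; rewrite !fE //.
    by move: il jl; rewrite /l; case: (leqP s u); lia.
  - move=> i il; rewrite /fan -val_eqE /= !fE //; [|lia].
    by move: il; rewrite /l; case: (leqP s u); lia.
  - move=> i j ij jl; rewrite /fan -val_eqE /= !fE //; [|lia].
    by move: jl; rewrite /l; case: (leqP s u); lia.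
by rewrite -f0 last_mkseq_succ.
Qed.

(** The hub is adjacent to all vertices, so a chordless path has at most one
vertex before it and at most one after it. *)
Lemma fan_chordless_hub s p : chordless_path (@fan n) s p -> ord0 \in s :: p ->
  size p <= 2.
Proof.
case=> _ hu hc hp.
have [i il iE] : exists2 i, i <= size p & nth s (s :: p) i = ord0.
  by exists (index ord0 (s :: p)); rewrite ?nth_index // -ltnS -/(size (s :: p)) index_mem.
have neq j : j <= size p -> j != i -> nth s (s :: p) j != ord0.
  by move=> jl; rewrite -iE nth_uniq.
have i1 : i <= 1.
  rewrite leqNgt; apply/negP => i2; have := hc 0 i i2 il.
  have := neq 0 isT; rewrite iE /fan => -> //; by rewrite ?orbT //; lia.
have : size p <= i.+1.
  rewrite leqNgt; apply/negP => i2; have := hc i _ i2 (leqnn _).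
  by rewrite iE /fan eq_sym neq //; lia.
lia.
Qed.

(** For two nonadjacent vertices other than the hub the detour through the hub
has length 2, which does not exceed their distance along the path. *)
Lemma fan_detour_dist s u : detour_dist (@fan n) s u (fan_dist s u).
Proof.
rewrite /fan_dist val_eqE; have [<-|su] := eqVneq s u; first exact: detour_dist_self.
case: ifP => hub; first by apply: detour_dist_adj; rewrite // /fan su /=; lia.
have [s0 u0] : 0 < s /\ 0 < u by lia.
have [adj|far] := boolP (fan s u).
  have -> : u - s + (s - u) = 1 by move: adj su; rewrite /fan -val_eqE /=; lia.
  exact: detour_dist_adj.
have [p [hp lp sp]] := fan_straight s0 u0.
exists p; split=> //; split=> // q hq lq.
have [h0|no0] := boolP (ord0 \in s :: q).
  apply: (leq_trans (fan_chordless_hub hq h0)); rewrite sp.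
  by move: far su; rewrite /fan -val_eqE /=; lia.
case: hq => hpath huniq _.
rewrite sp -lp -lq -(size_map val) -last_map (@consecutive_size (val s)) //.
  rewrite path_map; apply: sub_in_path hpath; last exact: allss.
  move=> x y hx hy; case/andP => _.
  have : x != ord0 by apply: contraNneq no0 => <-.
  have : y != ord0 by apply: contraNneq no0 => <-.
  by rewrite -!val_eqE /consecutive /=; lia.
by rewrite -map_cons map_inj_uniq //; apply: val_inj.
Qed.

(** * Minimum vertex covers of the fan *)

Lemma sum_fan_pairs (F : nat -> nat) :
  \sum_(u < n) F u = F 0 + \sum_(j < k) (F j.*2.+1 + F j.*2.+2).
Proof.
rewrite big_ord_recl /=; congr addn.
under eq_bigr do rewrite /bump add1n.
elim: k => [|l IH]; first by rewrite !big_ord0.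
by rewrite doubleS !big_ord_recr /= IH addnA.
Qed.

Lemma sum_set_fan_pairs (D : {set 'I_n}) (w : nat -> nat) :
  \sum_(u in D) w u = (ord0 \in D) * w 0 +
    \sum_(j < k) ((inord j.*2.+1 \in D) * w j.*2.+1 +
                  (inord j.*2.+2 \in D) * w j.*2.+2).
Proof.
have -> : ord0 = inord 0 :> 'I_n by apply: val_inj; rewrite /= inordK.
rewrite -(sum_fan_pairs (fun i => (inord i \in D) * w i)) big_mkcond /=.
by apply: eq_bigr => u _; rewrite inord_val; case: (u \in D); rewrite ?mul1n.
Qed.

(** A cover without the hub contains both ends of the first edge v_1 v_2, and
w 2 there makes up for the missing w 0. Unit weights give the size of a minimum
cover, the weights 2 ^ D_m(v_1, _) the lower bound on the pebbling number. *)
Lemma fan_cover_sum_ge (D : {set 'I_n}) (w : nat -> nat) :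
  0 < k -> vertex_cover (@fan n) D -> w 0 <= w 2 ->
  (forall j, w j.*2.+1 <= w j.*2.+2) ->
  w 0 + \sum_(j < k) w j.*2.+1 <= \sum_(u in D) w u.
Proof.
move=> k0 hD w02 wmono; rewrite sum_set_fan_pairs.
have pair (j : 'I_k) : (inord j.*2.+1 \in D) || (inord j.*2.+2 \in D).
  have jk := ltn_ord j.
  by apply: hD; rewrite /fan -val_eqE /= !inordK; lia.
have [h0|h0] := boolP (ord0 \in D).
  rewrite mul1n leq_add2l; apply: leq_sum => j _.
  have := pair j; have := wmono j.
  by do 2!case: (_ \in D) => //=; lia.
have all i : 0 < i -> i <= k.*2 -> inord i \in D.
  move=> i0 ik; have := hD ord0 (inord i).
  by rewrite (negbTE h0); apply; rewrite /fan -val_eqE /= inordK; lia.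
rewrite mul0n add0n.
rewrite [leqRHS](eq_bigr (fun j : 'I_k => w j.*2.+1 + w j.*2.+2)); last first.
  by move=> j _; have jk := ltn_ord j; rewrite !all ?mul1n //; lia.
rewrite big_split /= addnC leq_add2l.
case: k k0 => // l _; rewrite big_ord_recl /=; exact: leq_trans w02 (leq_addr _ _).
Qed.

(** For s > 0 this takes the end of each edge v_(2j+1) v_(2j+2) that is nearer
to v_s: the even end on the left of s, the odd end on the right. The index 0 is
even and at most s, which puts the hub into the cover; for s = 0 the other
elements are the odd vertices. *)
Definition fan_cover s : {set 'I_n} := [set i : 'I_n | if odd i then s <= i else i <= s].

Lemma fan_coverP s : vertex_cover (@fan n) (fan_cover s).
Proof.
move=> x y /andP[_]; rewrite !inE.
case/or4P => [/eqP ->|/eqP ->|/eqP <-|/eqP <-]; rewrite /= ?orbT //;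
  by case: (odd _) => /=; lia.
Qed.

Lemma sum_fan_cover s (w : nat -> nat) :
  \sum_(u in fan_cover s) w u =
  w 0 + \sum_(j < k) (if s <= j.*2.+1 then w j.*2.+1 else w j.*2.+2).
Proof.
rewrite sum_set_fan_pairs inE /= mul1n; congr addn; apply: eq_bigr => j _.
have jk := ltn_ord j.
rewrite !inE !inordK /= ?odd_double /=; [|lia ..].
by case: leqP; lia.
Qed.

Lemma fan_cover_minimum s : 0 < k -> minimum_vertex_cover (@fan n) (fan_cover s).
Proof.
move=> k0; split=> [|D hD]; first exact: fan_coverP.
rewrite -!sum1_card (sum_fan_cover s (fun=> 1)).
under [X in _ + X <= _]eq_bigr do rewrite if_same.
exact: (@fan_cover_sum_ge D (fun=> 1) k0 hD isT (fun=> isT)).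
Qed.

End Fan.

(** * Comparison of the costs *)

Lemma sum_exp4D a b :
  \sum_(j < a + b) 4 ^ j = \sum_(j < a) 4 ^ j + 4 ^ a * \sum_(j < b) 4 ^ j.
Proof.
by rewrite big_split_ord big_distrr /=; congr addn; apply: eq_bigr => j _; rewrite expnD.
Qed.

Lemma exp2_double j : 2 ^ j.*2 = 4 ^ j.
Proof. by rewrite -mul2n expnM. Qed.

(** With s = 2a + r and k = a + b, the edges on the left of v_s cost
2 ^ r * S(a), counted from v_s outwards, and those on the right
2 ^ (1 - r) * S(b), where S(l) is the sum of 4 ^ j over j < l. The factor 2 on
one side is absorbed by the factor 4 ^ a or 4 ^ b in S(a + b): for r = 0 the
hypothesis 0 < s gives 0 < a, and for r = 1 the bound s <= 2k gives 0 < b. *)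
Lemma path_cost_le k s : 0 < s -> s <= k.*2 ->
  \sum_(j < k) 2 ^ (if s <= j.*2.+1 then j.*2.+1 - s else s - j.*2.+2)
  <= \sum_(j < k) 4 ^ j.
Proof.
move=> s0 sk; pose a := s./2; pose r : nat := odd s.
have sE : s = a.*2 + r by rewrite addnC odd_double_half.
have [b kE] : exists b, k = a + b by exists (k - a); lia.
have r1 : r <= 1 by rewrite /r; case: odd.
clearbody a r; subst s k.
rewrite big_split_ord /=.
have -> : \sum_(i < a) 2 ^ (if a.*2 + r <= i.*2.+1 then i.*2.+1 - (a.*2 + r)
            else a.*2 + r - i.*2.+2) = 2 ^ r * \sum_(i < a) 4 ^ i.
  rewrite (reindex_inj rev_ord_inj) big_distrr; apply: eq_bigr => i _ /=.
  rewrite -exp2_double -expnD; congr (2 ^ _); have ia := ltn_ord i.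
  by case: leqP; lia.
have -> : \sum_(i < b) 2 ^ (if a.*2 + r <= (a + i).*2.+1
            then (a + i).*2.+1 - (a.*2 + r) else a.*2 + r - (a + i).*2.+2)
          = 2 ^ (1 - r) * \sum_(i < b) 4 ^ i.
  rewrite big_distrr; apply: eq_bigr => i _ /=.
  rewrite -exp2_double -expnD; congr (2 ^ _).
  by case: leqP; lia.
have exp4 l : 0 < l -> 2 <= 4 ^ l.
  by case: l => // l _; rewrite expnS; have := expn_gt0 4 l; lia.
(* Split S(a + b) so that the larger power multiplies the doubled side. *)
case: r r1 s0 sk => [|[|//]] _ s0 sk.
  by rewrite sum_exp4D mul1n leq_add2l leq_mul2r exp4 ?orbT //; lia.
by rewrite addnC [in leqRHS]addnC sum_exp4D mul1n leq_add2l leq_mul2r exp4 ?orbT //; lia.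
Qed.

Lemma hub_cost_le k : 0 < k -> k * 2 <= (\sum_(j < k) 4 ^ j).+1.
Proof.
elim: k => // -[|k] IH _; first by rewrite big_ord_recr big_ord0.
have pos : 0 < 4 ^ k by rewrite expn_gt0.
rewrite big_ord_recr /= expnS; move: (IH isT).
by set S := bigop _ _ _; lia.
Qed.

Theorem theorem2p4 (n : nat) (hn : 3 <= n) (hodd : odd n) :
  is_mu_vc (@fan n) ((\sum_(0 <= j < n./2) 2 ^ (2 * j)) + 2).
Proof.
have [k nE] : exists k, n = k.*2.+1 by exists n./2; lia.
subst n.
have k0 : 0 < k by lia.
have -> : \sum_(0 <= j < k.*2.+1./2) 2 ^ (2 * j) = \sum_(j < k) 4 ^ j.
  rewrite (_ : _./2 = k); last lia.
  by rewrite big_mkord; apply: eq_bigr => j _; rewrite expnM.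
split=> [s|m' hm'].
  exists (fan_cover s); first exact: fan_cover_minimum.
  apply/(can_pebbleP _ _ (@fan_detour_dist k s)).
  rewrite (@sum_fan_cover k s (fun u => 2 ^ fan_dist s u)).
  have [s0|s0] := posnP s.
    under eq_bigr do rewrite s0 /=.
    by rewrite s0 sum_nat_const card_ord; have := hub_cost_le k0; rewrite /fan_dist /=; lia.
  rewrite {1}/fan_dist gtn_eqF //= addnC leq_add2r.
  apply: leq_trans (path_cost_le s0 _); last by rewrite -ltnS.
  apply: leq_sum => j _; case: (leqP s j.*2.+1) => h;
    by rewrite fan_dist_path // leq_exp2l //; lia.
(* The end v_1 of the path attains the maximum over all sources. *)
have v1 : 1 < k.*2.+1 by lia.
have [D [hD _]] := hm' (Ordinal v1).
move/(can_pebbleP _ _ (@fan_detour_dist k _)) => /=; apply: leq_trans.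
rewrite addnC.
apply: leq_trans (@fan_cover_sum_ge k D (fun u => 2 ^ fan_dist 1 u) k0 hD _ _) => //.
  rewrite leq_add2l; apply: leq_sum => j _.
  by rewrite -exp2_double fan_dist_path // leq_exp2l //; lia.
by move=> j; rewrite !fan_dist_path // leq_exp2l //; lia.
Qed.
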